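(* Let $\mathcal{G}$ be a linear nested sequent. If $\mathcal{G}$ is valid, then $\mathcal{G}$ has a cyclic proof (an $\mathsf{LNS^{cyc}_{LTL}}$-proof).
   Context: **Language and semantics.** Let $\mathsf{Atm}$ be a denumerable set of atoms. Formulae of $\mathscr{L}$ are given by $A,B ::= p \mid \bot \mid (A \to B) \mid \mathtt{X} A \mid (A \,\mathtt{U}\, B)$ with $p \in \mathsf{Atm}$; $\neg A := A \to \bot$, $A \lor B := \neg A \to B$, $A \land B := \neg(A \to \neg B)$. A state sequence is an infinite sequence $\bar\sigma = (\sigma_0,\sigma_1,\ldots)$ with each $\sigma_i \subseteq \mathsf{Atm}$. Satisfaction at $i \ge 0$: $\bar\sigma,i \vDash p$ iff $p \in \sigma_i$; $\bar\sigma,i\not\vDash\bot$; $\bar\sigma,i\vDash A\to B$ iff $\bar\sigma,i\not\vDash A$ or $\bar\sigma,i\vDash B$; $\bar\sigma,i\vDash \mathtt{X}A$ iff $\bar\sigma,i+1\vDash A$; $\bar\sigma,i\vDash A\,\mathtt{U}\,B$ iff there is $j\ge i$ with $\bar\sigma,j\vDash B$ and $\bar\sigma,n\vDash A$ for all $i\le n<j$. $\bar\sigma\vDash A$ means $\bar\sigma,0\vDash A$; $A$ is valid iff $\bar\sigma\vDash A$ for every state sequence $\bar\sigma$. **Linear nested sequents.** A Gentzen sequent is $\Gamma\vdash\Delta$ with $\Gamma,\Delta$ finite sets of formulae. A linear nested sequent (LNS) is a nonempty finite sequence $\mathcal{G} = \Gamma_0\vdash\Delta_0 /\!/ \cdots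 /\!/ \Gamma_n\vdash\Delta_n$ of Gentzen sequents; $\Gamma_i\vdash\Delta_i$ is its $i$-component, $\Vert\mathcal{G}\Vert := n+1$ its length, and $\mathsf{end}(\mathcal{G}) := \Gamma_n\vdash\Delta_n$ its end component. Formula interpretation: $f(\Gamma\vdash\Delta) := \bigwedge\Gamma\to\bigvee\Delta$, $f(\Gamma\vdash\Delta /\!/ \mathcal{G}) := \bigwedge\Gamma\to(\bigvee\Delta\lor\mathtt{X}f(\mathcal{G}))$. $\mathcal{G}$ is valid iff $f(\mathcal{G})$ is valid. **Rules** ($\mathsf{LNS_{LTL}}$). Here $\mathcal{G},\mathcal{H}$ are possibly empty, and the comma is set union (so in ''$\Gamma, A$'' one may have $A\in\Gamma$). Initial rules (no premises): $\mathsf{id}$: $\mathcal{G}/\!/\Gamma,p\vdash p,\Delta/\!/\mathcal{H}$; $\bot\mathsf{L}$: $\mathcal{G}/\!/\Gamma,\bot\vdash\Delta/\!/\mathcal{H}$. Their conclusions are called initial sequents. Logical rules: - ${\to}\mathsf{R}$: from $\mathcal{G}/\!/\Gamma,A\vdash B,\Delta/\!/\mathcal{H}$ infer $\mathcal{G}/\!/\Gamma\vdash A\to B,\Delta/\!/\mathcal{H}$. - ${\to}\mathsf{L}$: from $\mathcal{G}/\!/\Gamma,B\vdash\Delta/\!/\mathcal{H}$ and $\mathcal{G}/\!/\Gamma\vdash A,\Delta/\!/\mathcal{H}$ infer $\mathcal{G}/\!/\Gamma,A\to B\vdash\Delta/\!/\mathcal{H}$. - $\mathtt{X}\mathsf{L}_1$: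 from $\mathcal{G}/\!/\Gamma\vdash\Delta/\!/\Sigma,A\vdash\Pi/\!/\mathcal{H}$ infer $\mathcal{G}/\!/\Gamma,\mathtt{X}A\vdash\Delta/\!/\Sigma\vdash\Pi/\!/\mathcal{H}$. - $\mathtt{X}\mathsf{L}_2$: from $\mathcal{G}/\!/\Gamma\vdash\Delta/\!/A\vdash$ infer $\mathcal{G}/\!/\Gamma,\mathtt{X}A\vdash\Delta$. - $\mathtt{X}\mathsf{R}_1$: from $\mathcal{G}/\!/\Gamma\vdash\Delta/\!/\Sigma\vdash A,\Pi/\!/\mathcal{H}$ infer $\mathcal{G}/\!/\Gamma\vdash\mathtt{X}A,\Delta/\!/\Sigma\vdash\Pi/\!/\mathcal{H}$. - $\mathtt{X}\mathsf{R}_2$: from $\mathcal{G}/\!/\Gamma\vdash\Delta/\!/\vdash A$ infer $\mathcal{G}/\!/\Gamma\vdash\mathtt{X}A,\Delta$. - $\mathtt{U}\mathsf{L}_1$: from (left) $\mathcal{G}/\!/\Gamma,B\vdash\Delta/\!/\Sigma\vdash\Pi/\!/\mathcal{H}$ and (right) $\mathcal{G}/\!/\Gamma,A\vdash\Delta/\!/\Sigma,A\,\mathtt{U}\,B\vdash\Pi/\!/\mathcal{H}$ infer $\mathcal{G}/\!/\Gamma,A\,\mathtt{U}\,B\vdash\Delta/\!/\Sigma\vdash\Pi/\!/\mathcal{H}$. - $\mathtt{U}\mathsf{R}_1$: from (left) $\mathcal{G}/\!/\Gamma\vdash A,B,\Delta/\!/\Sigma\vdash\Pi/\!/\mathcal{H}$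 and (right) $\mathcal{G}/\!/\Gamma\vdash B,\Delta/\!/\Sigma\vdash A\,\mathtt{U}\,B,\Pi/\!/\mathcal{H}$ infer $\mathcal{G}/\!/\Gamma\vdash A\,\mathtt{U}\,B,\Delta/\!/\Sigma\vdash\Pi/\!/\mathcal{H}$. - $\mathtt{U}\mathsf{L}_2$: from (left) $\mathcal{G}/\!/\Gamma,B\vdash\Delta$ and (right) $\mathcal{G}/\!/\Gamma,A\vdash\Delta/\!/A\,\mathtt{U}\,B\vdash$ infer $\mathcal{G}/\!/\Gamma,A\,\mathtt{U}\,B\vdash\Delta$. - $\mathtt{U}\mathsf{R}_2$: from (left) $\mathcal{G}/\!/\Gamma\vdash A,B,\Delta$ and (right) $\mathcal{G}/\!/\Gamma\vdash B,\Delta/\!/\vdash A\,\mathtt{U}\,B$ infer $\mathcal{G}/\!/\Gamma\vdash A\,\mathtt{U}\,B,\Delta$. **Derivations.** A derivation of $\mathcal{G}$ is a tree of LNSs with root $\mathcal{G}$ in which every parent node is the conclusion of a rule whose premises are its children (leaves need not be initial sequents). **Saturation.** An LNS $\mathcal{G}$ with components $\Gamma_0\vdash\Delta_0,\ldots,\Gamma_n\vdash\Delta_n$ is $i$-saturated ($0\le i\le n$) iff it is not an initial sequent and $\Gamma_i\cup\Delta_i$ contains no formula of the form $\mathtt{X}A$, $A\to B$ or $A\,\mathtt{U}\,B$. $\mathcal{G}$ is saturated iff it is $i$-saturated for each $0\le i<n$ (i.e., for every component other than the last). **Cyclic proofs.** A cyclic proof ($\mathsf{LNS^{cyc}_{LTL}}$-proof)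 of $\mathcal{G}$ is a tuple $(\pi,L,c)$ where (1) $\pi$ is a finite derivation of $\mathcal{G}$; (2) $L$ is a set of leaves of $\pi$ (cyclic leaves); (3) $c$ maps each leaf $\mathcal{F}\in L$ to a node $c(\mathcal{F})$ (its companion) lying on the path from the root to $\mathcal{F}$ and distinct from $\mathcal{F}$, such that $\Vert c(\mathcal{F})\Vert<\Vert\mathcal{F}\Vert$, the path from $c(\mathcal{F})$ to $\mathcal{F}$ goes through the right premise of a rule in $\{\mathtt{U}\mathsf{L}_1,\mathtt{U}\mathsf{L}_2\}$, both $c(\mathcal{F})$ and $\mathcal{F}$ are saturated, and $\mathsf{end}(c(\mathcal{F}))=\mathsf{end}(\mathcal{F})$; (4) every leaf of $\pi$ not in $L$ is an initial sequent. *)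

(* Defs.v *)
From HB Require Import structures.
From mathcomp Require Import all_boot finmap.

Set Implicit Arguments.
Unset Strict Implicit.
Unset Printing Implicit Defensive.

Local Open Scope fset_scope.

Inductive form (Atm : Type) : Type :=
| Atom of Atm
| Bot
| Imp of form Atm & form Atm
| Next of form Atm
| Until of form Atm & form Atm.

Arguments Bot {Atm}.

(* Encoding into generic trees; it only serves to equip [form Atm] with the
   choice structure required by [{fset form Atm}]. *)
Fixpoint form_encode (Atm : Type) (A : form Atm) : GenTree.tree Atm :=
  match A with
  | Atom p => GenTree.Leaf p
  | Bot => GenTree.Node 0 [::]
  | Imp B C => GenTree.Node 1 [:: form_encode B; form_encode C]
  | Next B => GenTree.Node 2 [:: form_encode B]
  | Until B C => GenTree.Node 3 [:: form_encode B; form_encode C]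
  end.

Fixpoint form_decode (Atm : Type) (t : GenTree.tree Atm) : option (form Atm) :=
  match t with
  | GenTree.Leaf p => Some (Atom p)
  | GenTree.Node 0 [::] => Some Bot
  | GenTree.Node 1 [:: u; v] =>
      if (form_decode u, form_decode v) is (Some B, Some C)
      then Some (Imp B C) else None
  | GenTree.Node 2 [:: u] => omap (@Next Atm) (form_decode u)
  | GenTree.Node 3 [:: u; v] =>
      if (form_decode u, form_decode v) is (Some B, Some C)
      then Some (Until B C) else None
  | _ => None
  end.

Lemma form_encodeK (Atm : Type) :
  pcancel (@form_encode Atm) (@form_decode Atm).
Proof. by elim=> //= [A -> B -> | A -> | A -> B ->]. Qed.

HB.instance Definition _ (Atm : eqType) :=
  Equality.copy (form Atm) (pcan_type (@form_encodeK Atm)).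
HB.instance Definition _ (Atm : choiceType) :=
  Choice.copy (form Atm) (pcan_type (@form_encodeK Atm)).
HB.instance Definition _ (Atm : countType) : isCountable (form Atm) :=
  PCanIsCountable (@form_encodeK Atm).

Definition Neg (Atm : Type) (A : form Atm) : form Atm := Imp A Bot.
Definition Or (Atm : Type) (A B : form Atm) : form Atm := Imp (Neg A) B.
Definition And (Atm : Type) (A B : form Atm) : form Atm := Neg (Imp A (Neg B)).
Definition Top (Atm : Type) : form Atm := Neg Bot.

Arguments Top {Atm}.

Definition state_sequence (Atm : Type) : Type := nat -> Atm -> Prop.

Fixpoint sat (Atm : Type) (sigma : state_sequence Atm) (i : nat)
    (A : form Atm) {struct A} : Prop :=
  match A with
  | Atom p => sigma i p
  | Bot => False
  | Imp B C => ~ sat sigma i B \/ sat sigma i C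
  | Next B => sat sigma i.+1 B
  | Until B C =>
      exists j, [/\ i <= j, sat sigma j C
                  & forall n, i <= n < j -> sat sigma n B]
  end.

Definition valid_form (Atm : Type) (A : form Atm) : Prop :=
  forall sigma : state_sequence Atm, sat sigma 0 A.

Definition sequent (Atm : countType) : Type :=
  ({fset form Atm} * {fset form Atm})%type.

Definition mk_sequent (Atm : countType) (Gamma Delta : {fset form Atm}) :
  sequent Atm := (Gamma, Delta).

Notation "Gamma ⊢ Delta" := (mk_sequent Gamma Delta)
  (at level 55, no associativity).

(* The empty sequence is not a linear nested sequent.  It is kept in the type
   because the contexts in the rules may be empty. *)
Definition lns (Atm : countType) : Type := seq (sequent Atm).

Definition end_component (Atm : countType) (G : lns Atm) : sequent Atm :=
  last (fset0 ⊢ fset0) G.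

Definition Conj (Atm : countType) (Gamma : {fset form Atm}) : form Atm :=
  \big[@And Atm/Top]_(A <- Gamma) A.

Definition Disj (Atm : countType) (Delta : {fset form Atm}) : form Atm :=
  \big[@Or Atm/Bot]_(A <- Delta) A.

(* The value at the empty sequence is junk. *)
Fixpoint interp (Atm : countType) (G : lns Atm) : form Atm :=
  match G with
  | [::] => Bot
  | [:: T] => Imp (Conj T.1) (Disj T.2)
  | T :: G' => Imp (Conj T.1) (Or (Disj T.2) (Next (interp G')))
  end.

Definition valid_lns (Atm : countType) (G : lns Atm) : Prop :=
  valid_form (interp G).

Inductive initial (Atm : countType) : lns Atm -> Prop :=
| init_id (G H : lns Atm) Gamma Delta (p : Atm) :
    initial (G ++ (Atom p |` Gamma ⊢ Atom p |` Delta) :: H)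
| init_botL (G H : lns Atm) Gamma Delta :
    initial (G ++ (Bot |` Gamma ⊢ Delta) :: H).

Inductive rule1 : Type := ImpR | XL1 | XL2 | XR1 | XR2.

Inductive rule2 : Type := ImpL | UL1 | UL2 | UR1 | UR2.

(* [infer1 r P C]: the rule [r] has an instance with premise [P] and
   conclusion [C]. *)
Inductive infer1 (Atm : countType) : rule1 -> lns Atm -> lns Atm -> Prop :=
| infer_ImpR (G H : lns Atm) Gamma Delta A B :
    infer1 ImpR (G ++ (A |` Gamma ⊢ B |` Delta) :: H)
                (G ++ (Gamma ⊢ Imp A B |` Delta) :: H)
| infer_XL1 (G H : lns Atm) Gamma Delta Sigma Pi A :
    infer1 XL1 (G ++ (Gamma ⊢ Delta) :: (A |` Sigma ⊢ Pi) :: H)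
               (G ++ (Next A |` Gamma ⊢ Delta) :: (Sigma ⊢ Pi) :: H)
| infer_XL2 (G : lns Atm) Gamma Delta A :
    infer1 XL2 (G ++ [:: Gamma ⊢ Delta; [fset A] ⊢ fset0])
               (G ++ [:: Next A |` Gamma ⊢ Delta])
| infer_XR1 (G H : lns Atm) Gamma Delta Sigma Pi A :
    infer1 XR1 (G ++ (Gamma ⊢ Delta) :: (Sigma ⊢ A |` Pi) :: H)
               (G ++ (Gamma ⊢ Next A |` Delta) :: (Sigma ⊢ Pi) :: H)
| infer_XR2 (G : lns Atm) Gamma Delta A :
    infer1 XR2 (G ++ [:: Gamma ⊢ Delta; fset0 ⊢ [fset A]])
               (G ++ [:: Gamma ⊢ Next A |` Delta]).

(* [infer2 r Pl Pr C]: the rule [r] has an instance with left premise [Pl],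
   right premise [Pr] and conclusion [C]. *)
Inductive infer2 (Atm : countType) :
    rule2 -> lns Atm -> lns Atm -> lns Atm -> Prop :=
| infer_ImpL (G H : lns Atm) Gamma Delta A B :
    infer2 ImpL (G ++ (B |` Gamma ⊢ Delta) :: H)
                (G ++ (Gamma ⊢ A |` Delta) :: H)
                (G ++ (Imp A B |` Gamma ⊢ Delta) :: H)
| infer_UL1 (G H : lns Atm) Gamma Delta Sigma Pi A B :
    infer2 UL1
      (G ++ (B |` Gamma ⊢ Delta) :: (Sigma ⊢ Pi) :: H)
      (G ++ (A |` Gamma ⊢ Delta) :: (Until A B |` Sigma ⊢ Pi) :: H)
      (G ++ (Until A B |` Gamma ⊢ Delta) :: (Sigma ⊢ Pi) :: H)
| infer_UR1 (G H : lns Atm) Gamma Delta Sigma Pi A B :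
    infer2 UR1
      (G ++ (Gamma ⊢ A |` (B |` Delta)) :: (Sigma ⊢ Pi) :: H)
      (G ++ (Gamma ⊢ B |` Delta) :: (Sigma ⊢ Until A B |` Pi) :: H)
      (G ++ (Gamma ⊢ Until A B |` Delta) :: (Sigma ⊢ Pi) :: H)
| infer_UL2 (G : lns Atm) Gamma Delta A B :
    infer2 UL2
      (G ++ [:: B |` Gamma ⊢ Delta])
      (G ++ [:: A |` Gamma ⊢ Delta; [fset Until A B] ⊢ fset0])
      (G ++ [:: Until A B |` Gamma ⊢ Delta])
| infer_UR2 (G : lns Atm) Gamma Delta A B :
    infer2 UR2
      (G ++ [:: Gamma ⊢ A |` (B |` Delta)])
      (G ++ [:: Gamma ⊢ B |` Delta; fset0 ⊢ [fset Until A B]])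
      (G ++ [:: Gamma ⊢ Until A B |` Delta]).

(* Inner nodes also record the rule applied, as the same premises and
   conclusion may be an instance of several rules. *)
Inductive dtree (Atm : countType) : Type :=
| Leaf of lns Atm
| Unary of rule1 & lns Atm & dtree Atm
| Binary of rule2 & lns Atm & dtree Atm & dtree Atm.

Definition root_label (Atm : countType) (t : dtree Atm) : lns Atm :=
  match t with
  | Leaf G => G
  | Unary _ G _ => G
  | Binary _ G _ _ => G
  end.

Fixpoint derivation (Atm : countType) (t : dtree Atm) : Prop :=
  match t with
  | Leaf _ => True
  | Unary r G u => infer1 r (root_label u) G /\ derivation u
  | Binary r G u v =>
      [/\ infer2 r (root_label u) (root_label v) G, derivation u & derivation v]
  end.

(* Nodes are addressed by the path from the root: [false] goes to the left or
   only premise, [true] to the right premise. *)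
Definition address : Type := seq bool.

Fixpoint subtree (Atm : countType) (t : dtree Atm) (a : address) :
    option (dtree Atm) :=
  match a, t with
  | [::], _ => Some t
  | false :: a', Unary _ _ u => subtree u a'
  | false :: a', Binary _ _ u _ => subtree u a'
  | true :: a', Binary _ _ _ v => subtree v a'
  | _, _ => None
  end.

Definition node_at (Atm : countType) (t : dtree Atm) (a : address)
    (G : lns Atm) : Prop :=
  omap (@root_label Atm) (subtree t a) = Some G.

Definition leaf_at (Atm : countType) (t : dtree Atm) (a : address)
    (G : lns Atm) : Prop :=
  subtree t a = Some (Leaf G).

Definition compound (Atm : Type) (A : form Atm) : bool :=
  match A with
  | Next _ | Imp _ _ | Until _ _ => true
  | Atom _ | Bot => false
  end.

Definition i_saturated (Atm : countType) (i : nat) (G : lns Atm) : Prop :=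
  let T := nth (fset0 ⊢ fset0) G i in
  [/\ i < size G, ~ initial G
    & forall A, A \in T.1 `|` T.2 -> ~~ compound A].

Definition saturated (Atm : countType) (G : lns Atm) : Prop :=
  forall i, i < (size G).-1 -> i_saturated i G.

Definition through_UL_right (Atm : countType) (t : dtree Atm)
    (b a : address) : Prop :=
  exists d1 d2 r G u v,
    [/\ a = b ++ d1 ++ true :: d2,
        subtree t (b ++ d1) = Some (Binary r G u v)
      & r = UL1 \/ r = UL2].

Definition is_companion (Atm : countType) (t : dtree Atm)
    (b a : address) : Prop :=
  [/\ prefix b a, b <> a, through_UL_right t b a
    & exists C F, [/\ node_at t b C /\ node_at t a F,
                      size C < size F,
                      saturated C, saturated F
                    & end_component C = end_component F]].

(* Only the values of [c] on the set [L] of cyclic leaves matter. *)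
Definition cyclic_proof (Atm : countType) (G : lns Atm) (pi : dtree Atm)
    (L : {fset address}) (c : address -> address) : Prop :=
  [/\ derivation pi /\ root_label pi = G,
      forall a, a \in L -> exists F, leaf_at pi a F,
      forall a, a \in L -> is_companion pi (c a) a
    & forall a F, leaf_at pi a F -> a \notin L -> initial F].

Definition has_cyclic_proof (Atm : countType) (G : lns Atm) : Prop :=
  exists pi L c, cyclic_proof G pi L c.

(* Main.v *)
Require Import Defs.
From HB Require Import structures.
From mathcomp Require Import all_boot finmap zify.
From Stdlib Require Import ClassicalEpsilon Relations.

(* Apply the rules to the first component until it contains no compound
   formula, then pass to the next one.  Every rule is invertible, so validity is
   preserved, and each decomposed component is the state of an instant.  Past
   the original components, the last one ranges over the finitely many sequents
   of subformulae, so on every branch that avoids initial sequents some end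
   component T recurs.  If the segment between the two occurrences never took
   the right premise of a left until rule, every eventuality met on it would
   have been fulfilled at once, and repeating the segment for ever would give a
   Hintikka sequence refuting the linear nested sequent.  Hence every
   recurrence is a legitimate cycle. *)

Set Implicit Arguments.
Unset Strict Implicit.
Unset Printing Implicit Defensive.

Local Open Scope fset_scope.
Local Open Scope nat_scope.

(** * Refutation of linear nested sequents *)

Definition refutes (Atm : countType) (sigma : state_sequence Atm) (i : nat)
    (T : sequent Atm) : Prop :=
  (forall A, A \in T.1 -> sat sigma i A) /\
  (forall A, A \in T.2 -> ~ sat sigma i A).

(** The negation of [interp], unfolded to one component per instant. The value [True] at the empty
    sequence lets it split along concatenation. *)
Fixpoint lns_refutes (Atm : countType) (sigma : state_sequence Atm) (i : nat)
    (G : lns Atm) : Prop :=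
  if G is T :: G' then refutes sigma i T /\ lns_refutes sigma i.+1 G'
  else True.

Definition irrefutable (Atm : countType) (G : lns Atm) : Prop :=
  forall sigma, ~ lns_refutes sigma 0 G.

Lemma sat_Conj (Atm : countType) (sigma : state_sequence Atm) i
    (Gamma : {fset form Atm}) :
  (forall A, A \in Gamma -> sat sigma i A) -> sat sigma i (Conj Gamma).
Proof.
move=> h; rewrite /Conj big_seq; elim/big_ind: _ => [||A /h //] /=; first by left.
by move=> A B sA sB; left; case=> // -[].
Qed.

Lemma nsat_Disj (Atm : countType) (sigma : state_sequence Atm) i
    (Delta : {fset form Atm}) :
  (forall A, A \in Delta -> ~ sat sigma i A) -> ~ sat sigma i (Disj Delta).
Proof.
move=> h; rewrite /Disj big_seq; elim/big_ind: _ => [||A /h //] /=; first by case.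
by move=> A B nA nB [] // []; left.
Qed.

Lemma lns_refutes_interp (Atm : countType) (sigma : state_sequence Atm)
    (G : lns Atm) i :
  G <> [::] -> lns_refutes sigma i G -> ~ sat sigma i (interp G).
Proof.
elim: G i => [|T [|T' G] IH] i // _ [[/sat_Conj hT1 /nsat_Disj hT2] hG].
  by case.
case; first by apply.
case; last by apply: IH.
by apply; left.
Qed.

Lemma valid_irrefutable (Atm : countType) (G : lns Atm) :
  G <> [::] -> valid_lns G -> irrefutable G.
Proof. by move=> G0 vG sigma /(lns_refutes_interp G0); apply. Qed.

Lemma lns_refutes_cat (Atm : countType) (sigma : state_sequence Atm)
    (G H : lns Atm) i :
  lns_refutes sigma i (G ++ H) <->
  lns_refutes sigma i G /\ lns_refutes sigma (i + size G) H.
Proof.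
elim: G i => [|T G IH] i /=; first by rewrite addn0; tauto.
by have := IH i.+1; rewrite addSnnS; tauto.
Qed.

Lemma lns_refutesP (Atm : countType) (sigma : state_sequence Atm)
    (G : lns Atm) i :
  (forall k, k < size G -> refutes sigma (i + k) (nth (fset0 ⊢ fset0) G k)) ->
  lns_refutes sigma i G.
Proof.
elim: G i => [|T G IH] i //= h; split; first by have := h 0; rewrite addn0; apply.
by apply: IH => k kG; have := h k.+1; rewrite addSnnS; apply.
Qed.

(** * Hintikka sequences and their truth lemma *)

(* Local conditions of a Hintikka sequence: [L], [R] are the formulae made
   true and false now, [L'], [R'] those made true and false at the next
   instant.  Eventualities in [L] are required to be fulfilled at once. *)
Definition decomposesL (Atm : Type) (L R L' : form Atm -> Prop) (X : form Atm) :
    Prop :=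
  match X with
  | Imp A B => R A \/ L B
  | Next A => L' A
  | Until A B => L B
  | _ => True
  end.

Definition decomposesR (Atm : Type) (L R R' : form Atm -> Prop) (X : form Atm) :
    Prop :=
  match X with
  | Imp A B => L A /\ R B
  | Next A => R' A
  | Until A B => R B /\ (R A \/ R' X)
  | _ => True
  end.

Definition decomposed (Atm : Type) (L R L' R' : form Atm -> Prop) : Prop :=
  (forall X, L X -> decomposesL L R L' X) /\
  (forall X, R X -> decomposesR L R R' X).

Lemma decomposesL_mono (Atm : Type) (L R L' M S M' : form Atm -> Prop) X :
  (forall A, L A -> M A) -> (forall A, R A -> S A) -> (forall A, L' A -> M' A) ->
  decomposesL L R L' X -> decomposesL M S M' X.
Proof.
move=> hL hR hL'; case: X => [p||A B|A|A B] /=; [by []|by []| |exact: hL'|exact: hL].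
by case=> [/hR|/hL]; [left|right].
Qed.

Lemma decomposesR_mono (Atm : Type) (L R R' M S S' : form Atm -> Prop) X :
  (forall A, L A -> M A) -> (forall A, R A -> S A) -> (forall A, R' A -> S' A) ->
  decomposesR L R R' X -> decomposesR M S S' X.
Proof.
move=> hL hR hR'; case: X => [p||A B [/hL ? /hR ?]|A|A B] /=; [by []|by []|by []|exact: hR'|].
by case=> /hR ? [/hR|/hR']; split=> //; [left|right].
Qed.

Definition consistent (Atm : Type) (L R : form Atm -> Prop) : Prop :=
  ~ L Bot /\ forall p, L (Atom p) -> ~ R (Atom p).

Lemma decomposed_mono (Atm : Type) (L R L' R' L'' R'' : form Atm -> Prop) :
  (forall A, L' A -> L'' A) -> (forall A, R' A -> R'' A) ->
  decomposed L R L' R' -> decomposed L R L'' R''.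
Proof.
move=> hL hR [dL dR]; split=> X; first by move/dL; apply: decomposesL_mono.
by move/dR; apply: decomposesR_mono.
Qed.

(** Induction on the formula, with both sides treated together because implication exchanges them. A
    true until is witnessed at its own instant; a false one needs an inner induction along the
    instants. *)
Lemma hintikka_truth (Atm : Type) (L R : nat -> form Atm -> Prop) :
  (forall i, decomposed (L i) (R i) (L i.+1) (R i.+1)) ->
  (forall i, consistent (L i) (R i)) ->
  forall A i, (L i A -> sat (fun j p => L j (Atom p)) i A) /\
              (R i A -> ~ sat (fun j p => L j (Atom p)) i A).
Proof.
move=> dec con; elim=> [p||A IA B IB|A IA|A IA B IB] i /=.
- by split=> // rp lp; case: (con i) => _ /(_ p lp).
- by split=> [lB|_ []]; case: (con i) => /(_ lB).
- split=> [/(proj1 (dec i) _) [/(proj2 (IA i))|/(proj1 (IB i))]|].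
  + by move=> ?; left.
  + by move=> ?; right.
  by move=> /(proj2 (dec i) _) [/(proj1 (IA i)) ? /(proj2 (IB i)) ?] [].
- split=> [/(proj1 (dec i) _)|/(proj2 (dec i) _)]; first exact: (proj1 (IA _)).
  exact: (proj2 (IA _)).
- split=> [/(proj1 (dec i) _) /(proj1 (IB i)) ?|].
    by exists i; split=> // n; rewrite ltnNge andbN.
  move=> rU [j [ij sB sA]].
  have [d def_j] : exists d, j = i + d by exists (j - i); rewrite subnKC.
  (* As long as the left argument holds, a false until is handed on to the next instant; it thus
     reaches the alleged witness [j], where it forces the right argument to be false. *)
  have {rU} : R j (Until A B).
    move: sA; rewrite {j ij sB}def_j; elim: d => [|d IHd] sA; first by rewrite addn0.
    have {}IHd : R (i + d) (Until A B).
      by apply: IHd => n /andP[n1 n2]; apply: sA; lia.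
    have [_ [rA|]] := proj2 (dec _) _ IHd; last by rewrite addnS.
    by case: (proj2 (IA _) rA); apply: sA; lia.
  by case/(proj2 (dec j) _) => /(proj2 (IB j)).
Qed.

(** * Atomic and axiomatic sequents, and countermodels from infinite runs *)

Definition atomic (Atm : countType) (T : sequent Atm) : bool :=
  all (fun A => ~~ compound A) (T.1 `|` T.2).

(** Decidable form of being initial, for one component. The shared formula in the second disjunct
    may also be [Bot], which the first disjunct covers anyway. *)
Definition axiomatic (Atm : countType) (T : sequent Atm) : bool :=
  (Bot \in T.1) || has (fun A => ~~ compound A && (A \in T.2)) T.1.

Lemma axiomaticPn (Atm : countType) (T : sequent Atm) :
  ~~ axiomatic T -> consistent (fun A => A \in T.1) (fun A => A \in T.2).
Proof.
case/norP => nB /hasPn h; split; first by apply/negP.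
by move=> p /h /=; move/negP.
Qed.

Lemma initialP (Atm : countType) (G : lns Atm) :
  reflect (initial G) (has (@axiomatic Atm) G).
Proof.
apply: (iffP hasP) => [[T /path.splitPr [G1 G2]] |].
  case: T => Gamma Delta /orP [/= hB|/hasP [A /= AG /andP [cA AD]]].
    by rewrite -(mem_fset1U hB); exact: init_botL.
  case: A cA AG AD => // [p _ h1 h2|_ h1 h2].
    by rewrite -(mem_fset1U h1) -(mem_fset1U h2); exact: init_id.
  by rewrite -(mem_fset1U h1); exact: init_botL.
case=> [G1 G2 Gamma Delta p|G1 G2 Gamma Delta].
  exists (Atom p |` Gamma ⊢ Atom p |` Delta); first by rewrite mem_cat mem_head orbT.
  by apply/orP; right; apply/hasP; exists (Atom p); rewrite /= fset1U1.
exists (Bot |` Gamma ⊢ Delta); first by rewrite mem_cat mem_head orbT.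
by rewrite /axiomatic /= fset1U1.
Qed.

(** Only compound formulae impose conditions, so an atomic sequent admits any successor. *)
Lemma atomic_decomposed (Atm : countType) (T : sequent Atm) L' R' :
  atomic T -> decomposed (fun A => A \in T.1) (fun A => A \in T.2) L' R'.
Proof.
move=> /allP aT.
split=> X XT.
  have /aT : X \in T.1 `|` T.2 by rewrite inE XT.
  by case: X {XT}.
have /aT : X \in T.1 `|` T.2 by rewrite inE XT orbT.
by case: X {XT}.
Qed.

(* [S] may follow [T] on a branch that never takes the right premise of a
   left until rule. *)
Definition open_step (Atm : countType) (T S : sequent Atm) : Prop :=
  exists L R, [/\ forall A, A \in T.1 -> L A, forall A, A \in T.2 -> R A,
    decomposed L R (fun A => A \in S.1) (fun A => A \in S.2) & consistent L R].

(** The sets [L] and [R] supplied by the successive open steps form a Hintikka sequence, and the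
    atoms in its left sets are the refuting state sequence. *)
Lemma open_run_refuted (Atm : countType) (H : lns Atm) (T : nat -> sequent Atm) :
  (forall k, open_step (T k) (T k.+1)) ->
  all (@atomic Atm) H -> ~~ has (@axiomatic Atm) H ->
  ~ irrefutable (H ++ [:: T 0]).
Proof.
move=> stepT aH /hasPn nH irr.
(* One component per instant: the atomic prefix [H] first, then the run, shifted so that [T 0] comes
   right after [H]. *)
pose U i := if i < size H then nth (fset0 ⊢ fset0) H i else T (i - size H).
have stepU i : open_step (U i) (U i.+1).
  rewrite /U; case: (ltnP i (size H)) => iH; last first.
    by rewrite ltnNge leqW //= subSn.
  exists (fun A => A \in (nth (fset0 ⊢ fset0) H i).1).
  exists (fun A => A \in (nth (fset0 ⊢ fset0) H i).2).
  split=> //; first by apply: atomic_decomposed; apply: (allP aH); exact: mem_nth.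
  by apply/axiomaticPn/nH/mem_nth.
(* A step only asserts that a pair of sets exists; one is chosen for each instant, so that
   consecutive pairs can be compared. *)
pose LR i := epsilon (inhabits ((fun _ => True), (fun _ => True)))
  (fun X : (form Atm -> Prop) * (form Atm -> Prop) =>
  [/\ forall A, A \in (U i).1 -> X.1 A, forall A, A \in (U i).2 -> X.2 A,
    decomposed X.1 X.2 (fun A => A \in (U i.+1).1) (fun A => A \in (U i.+1).2)
   & consistent X.1 X.2]).
have LRP i : [/\ forall A, A \in (U i).1 -> (LR i).1 A,
    forall A, A \in (U i).2 -> (LR i).2 A,
    decomposed (LR i).1 (LR i).2
      (fun A => A \in (U i.+1).1) (fun A => A \in (U i.+1).2)
   & consistent (LR i).1 (LR i).2].
  rewrite /LR; apply epsilon_spec; case: (stepU i) => L [R hLR].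
  by exists (L, R).
apply: (irr (fun i p => (LR i).1 (Atom p))); apply: lns_refutesP => k.
rewrite size_cat addn1 ltnS add0n => kH.
have -> : nth (fset0 ⊢ fset0) (H ++ [:: T 0]) k = U k.
  rewrite /U nth_cat; case: ltnP => // Hk.
  have -> : k = size H by apply/eqP; rewrite eqn_leq kH.
  by rewrite subnn.
have [hL hR _ _] := LRP k.
(* Step [i] puts its obligations into [U i.+1], which is contained in the sets chosen for instant
   [i.+1]. *)
have dec i : decomposed (LR i).1 (LR i).2 (LR i.+1).1 (LR i.+1).2.
  have [_ _ d _] := LRP i; have [h1 h2 _ _] := LRP i.+1.
  exact: decomposed_mono d.
have con i : consistent (LR i).1 (LR i).2 by case: (LRP i).
by split=> A; [move/hL/(proj1 (hintikka_truth dec con A k))|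
                 move/hR/(proj2 (hintikka_truth dec con A k))].
Qed.

Lemma clos_trans_head (T : Type) (r : relation T) x z :
  clos_trans T r x z -> exists2 y, r x y & y = z \/ clos_trans T r y z.
Proof.
elim=> {x z} [x z xz|x y z _ [w xw wy] yz _]; first by exists z => //; left.
exists w => //; right; case: wy => [->|wy] //.
exact: t_trans wy yz.
Qed.

(** Unwinding the loop gives an infinite run: each successor is chosen among those from which [T]
    can be reached again. *)
Lemma open_loop_refuted (Atm : countType) (H : lns Atm) (T : sequent Atm) :
  clos_trans _ (@open_step Atm) T T ->
  all (@atomic Atm) H -> ~~ has (@axiomatic Atm) H ->
  ~ irrefutable (H ++ [:: T]).
Proof.
move=> loop aH nH.
pose next X := epsilon (inhabits (fset0 ⊢ fset0))
  (fun Y => open_step X Y /\ clos_trans _ (@open_step Atm) Y T).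
have nextP X : clos_trans _ (@open_step Atm) X T ->
    open_step X (next X) /\ clos_trans _ (@open_step Atm) (next X) T.
  move=> XT; apply epsilon_spec.
  have [Y XY [YT|YT]] := clos_trans_head XT; last by exists Y.
  (* The path has come back to [T], where the loop starts anew. *)
  by exists T; rewrite -{1}YT.
pose run k := iter k next T.
have runT k : clos_trans _ (@open_step Atm) (run k) T.
  by elim: k => //= k /nextP [].
by apply: (@open_run_refuted _ H run) => // k; case: (nextP _ (runT k)).
Qed.

(** An atomic end component puts no demand on later instants, so the run is prolonged by empty
    sequents. *)
Lemma atomic_refuted (Atm : countType) (H : lns Atm) (T : sequent Atm) :
  all (@atomic Atm) (H ++ [:: T]) -> ~~ has (@axiomatic Atm) (H ++ [:: T]) ->
  ~ irrefutable (H ++ [:: T]).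
Proof.
rewrite all_cat has_cat /= andbT orbF => /andP [aH aT] /norP [nH nT].
pose run k := if k is 0 then T else (fset0 ⊢ fset0 : sequent Atm).
apply: (@open_run_refuted _ H run) => //.
have step S S' : atomic S -> ~~ axiomatic S -> @open_step Atm S S'.
  move=> aS nS; exists (fun A => A \in S.1), (fun A => A \in S.2).
  by split=> //; [exact: atomic_decomposed|exact: axiomaticPn].
case=> [|k]; apply: step => //; first by apply/allP => A; rewrite !inE.
Qed.

(** * Decomposing one component *)

(** Treats the two variants of a rule uniformly: the formula joins the next component, or opens a
    new one when there is none. [pushR] does the same on the right. *)
Definition pushL (Atm : countType) (A : form Atm) (R : lns Atm) : lns Atm :=
  if R is (Sigma, Pi) :: R' then (A |` Sigma ⊢ Pi) :: R'
  else [:: [fset A] ⊢ fset0].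

Definition pushR (Atm : countType) (A : form Atm) (R : lns Atm) : lns Atm :=
  if R is (Sigma, Pi) :: R' then (Sigma ⊢ A |` Pi) :: R'
  else [:: fset0 ⊢ [fset A]].

(* [expand b T R T' R']: a rule whose principal formula lies in [T] leads from
   the conclusion [H ++ T :: R] to the premise [H ++ T' :: R'], for every [H];
   [b] marks the right premise of a left until rule.  The principal formula is
   dropped, so that component [T] shrinks. *)
Inductive expand (Atm : countType) :
    bool -> sequent Atm -> lns Atm -> sequent Atm -> lns Atm -> Prop :=
| expand_ImpR Gamma Delta R A B : Imp A B \in Delta ->
    expand false (Gamma ⊢ Delta) R (A |` Gamma ⊢ B |` (Delta `\ Imp A B)) R
| expand_ImpLl Gamma Delta R A B : Imp A B \in Gamma ->
    expand false (Gamma ⊢ Delta) R (B |` (Gamma `\ Imp A B) ⊢ Delta) R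
| expand_ImpLr Gamma Delta R A B : Imp A B \in Gamma ->
    expand false (Gamma ⊢ Delta) R (Gamma `\ Imp A B ⊢ A |` Delta) R
| expand_NextL Gamma Delta R A : Next A \in Gamma ->
    expand false (Gamma ⊢ Delta) R (Gamma `\ Next A ⊢ Delta) (pushL A R)
| expand_NextR Gamma Delta R A : Next A \in Delta ->
    expand false (Gamma ⊢ Delta) R (Gamma ⊢ Delta `\ Next A) (pushR A R)
| expand_UntilLl Gamma Delta R A B : Until A B \in Gamma ->
    expand false (Gamma ⊢ Delta) R (B |` (Gamma `\ Until A B) ⊢ Delta) R
| expand_UntilLr Gamma Delta R A B : Until A B \in Gamma ->
    expand true (Gamma ⊢ Delta) R
      (A |` (Gamma `\ Until A B) ⊢ Delta) (pushL (Until A B) R)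
| expand_UntilRl Gamma Delta R A B : Until A B \in Delta ->
    expand false (Gamma ⊢ Delta) R
      (Gamma ⊢ A |` (B |` (Delta `\ Until A B))) R
| expand_UntilRr Gamma Delta R A B : Until A B \in Delta ->
    expand false (Gamma ⊢ Delta) R
      (Gamma ⊢ B |` (Delta `\ Until A B)) (pushR (Until A B) R).

Definition is_UL (r : rule2) : bool :=
  match r with UL1 | UL2 => true | _ => false end.

(** Any compound member of [T] can be principal. As the comma is set union, the rule may be
    instantiated with the context from which that formula is removed; [fsetD1K] restores it in the
    conclusion. *)
Lemma expand_total (Atm : countType) (T : sequent Atm) (R : lns Atm) :
  ~~ atomic T ->
  (exists T' R', expand false T R T' R' /\
     forall H, exists r, infer1 r (H ++ T' :: R') (H ++ T :: R)) \/
  (exists b Tl Rl Tr Rr, [/\ expand false T R Tl Rl, expand b T R Tr Rr &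
     forall H, exists2 r, is_UL r = b &
       infer2 r (H ++ Tl :: Rl) (H ++ Tr :: Rr) (H ++ T :: R)]).
Proof.
case: T => Gamma Delta /allPn [X]; rewrite inE negbK /= => /orP [] XT.
  case: X XT => // [A B|A|A B] XT _.
  - right; exists false, (B |` (Gamma `\ Imp A B) ⊢ Delta), R.
    exists (Gamma `\ Imp A B ⊢ A |` Delta), R.
    split; [exact: expand_ImpLl|exact: expand_ImpLr|] => H.
    by exists ImpL => //; rewrite -{3}(fsetD1K XT); apply: infer_ImpL.
  - left; exists (Gamma `\ Next A ⊢ Delta), (pushL A R).
    split=> [|H]; first exact: expand_NextL.
    rewrite -{2}(fsetD1K XT); case: R => [|[Sigma Pi] R] /=.
      by exists XL2; apply: infer_XL2.
    by exists XL1; apply: infer_XL1.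
  - right; exists true, (B |` (Gamma `\ Until A B) ⊢ Delta), R.
    exists (A |` (Gamma `\ Until A B) ⊢ Delta), (pushL (Until A B) R).
    split; [exact: expand_UntilLl|exact: expand_UntilLr|] => H.
    rewrite -{3}(fsetD1K XT); case: R => [|[Sigma Pi] R] /=.
      by exists UL2 => //; apply: infer_UL2.
    by exists UL1 => //; apply: infer_UL1.
case: X XT => // [A B|A|A B] XT _.
- left; exists (A |` Gamma ⊢ B |` (Delta `\ Imp A B)), R.
  split=> [|H]; first exact: expand_ImpR.
  by exists ImpR; rewrite -{2}(fsetD1K XT); apply: infer_ImpR.
- left; exists (Gamma ⊢ Delta `\ Next A), (pushR A R).
  split=> [|H]; first exact: expand_NextR.
  rewrite -{2}(fsetD1K XT); case: R => [|[Sigma Pi] R] /=.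
    by exists XR2; apply: infer_XR2.
  by exists XR1; apply: infer_XR1.
- right; exists false, (Gamma ⊢ A |` (B |` (Delta `\ Until A B))), R.
  exists (Gamma ⊢ B |` (Delta `\ Until A B)), (pushR (Until A B) R).
  split; [exact: expand_UntilRl|exact: expand_UntilRr|] => H.
  rewrite -{3}(fsetD1K XT); case: R => [|[Sigma Pi] R] /=.
    by exists UR2 => //; apply: infer_UR2.
  by exists UR1 => //; apply: infer_UR1.
Qed.

Fixpoint form_size (Atm : countType) (A : form Atm) : nat :=
  match A with
  | Atom _ | Bot => 1
  | Imp B C | Until B C => (form_size B + form_size C).+1
  | Next B => (form_size B).+1
  end.

Definition set_size (Atm : countType) (X : {fset form Atm}) : nat :=
  \sum_(A <- X) form_size A.

Lemma set_sizeU1 (Atm : countType) (A : form Atm) X :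
  set_size (A |` X) <= form_size A + set_size X.
Proof.
rewrite /set_size; case AX: (A \in X); last by rewrite big_fsetU1 ?AX.
by rewrite mem_fset1U // leq_addl.
Qed.

Lemma set_sizeD1 (Atm : countType) (A : form Atm) X :
  A \in X -> set_size X = form_size A + set_size (X `\ A).
Proof. by move=> AX; rewrite /set_size (big_fsetD1 A). Qed.

Definition seqt_size (Atm : countType) (T : sequent Atm) : nat :=
  set_size T.1 + set_size T.2.

(* Generalizing identifies sizes that are convertible but differ in implicit
   arguments, which [lia] would take for distinct atoms. *)
Ltac gen := do ?move: (set_size _); do ?move: (form_size _) => ?; lia.

(** The principal formula leaves [T] and at most its immediate subformulae enter, whose sizes add up
    to less. What is pushed to the next component is not counted. *)
Lemma expand_size (Atm : countType) b (T T' : sequent Atm) R R' :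
  expand b T R T' R' -> seqt_size T' < seqt_size T.
Proof.
have le1 (A : form Atm) X := set_sizeU1 A X.
have le2 (A B : form Atm) X : set_size (A |` (B |` X)) <=
    form_size A + (form_size B + set_size X).
  by apply: leq_trans (le1 _ _) _; rewrite leq_add2l.
case=> {b T T' R R'} Gamma Delta R A => [B|B|B|||B|B|B|B] /set_sizeD1 /= def_s;
  rewrite /seqt_size /= def_s.
- by move: (le1 A Gamma) (le1 B (Delta `\ Imp A B)); gen.
- by move: (le1 B (Gamma `\ Imp A B)); gen.
- by move: (le1 A Delta); gen.
- by gen.
- by gen.
- by move: (le1 B (Gamma `\ Until A B)); gen.
- by move: (le1 A (Gamma `\ Until A B)); gen.
- by move: (le2 A B (Delta `\ Until A B)); gen.
- by move: (le1 B (Delta `\ Until A B)); gen.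
Qed.

Lemma pushL_refutes (Atm : countType) sigma i (A : form Atm) R :
  lns_refutes sigma i (pushL A R) ->
  sat sigma i A /\ lns_refutes sigma i R.
Proof.
case: R => [|[Sigma Pi] R] /= [[h1 h2] hR].
  by split=> //; apply: h1; rewrite inE.
split; first by apply: h1; rewrite fset1U1.
by split=> //; split=> // B BS; apply: h1; rewrite fset1Ur.
Qed.

Lemma pushR_refutes (Atm : countType) sigma i (A : form Atm) R :
  lns_refutes sigma i (pushR A R) ->
  ~ sat sigma i A /\ lns_refutes sigma i R.
Proof.
case: R => [|[Sigma Pi] R] /= [[h1 h2] hR].
  by split=> //; apply: h2; rewrite inE.
split; first by apply: h2; rewrite fset1U1.
by split=> //; split=> // B BS; apply: h2; rewrite fset1Ur.
Qed.

Lemma refutesD1L (Atm : countType) sigma i (A : form Atm) Gamma Delta :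
  sat sigma i A -> refutes sigma i (Gamma `\ A ⊢ Delta) ->
  refutes sigma i (Gamma ⊢ Delta).
Proof.
move=> sA [h1 h2]; split=> //= B BG.
by have [->|BA] := eqVneq B A => //; apply: h1; rewrite !inE BA.
Qed.

Lemma refutesD1R (Atm : countType) sigma i (A : form Atm) Gamma Delta :
  ~ sat sigma i A -> refutes sigma i (Gamma ⊢ Delta `\ A) ->
  refutes sigma i (Gamma ⊢ Delta).
Proof.
move=> sA [h1 h2]; split=> //= B BG.
by have [->|BA] := eqVneq B A => //; apply: h2; rewrite !inE BA.
Qed.

Lemma refutesU1L (Atm : countType) sigma i (A : form Atm) Gamma Delta :
  refutes sigma i (A |` Gamma ⊢ Delta) ->
  sat sigma i A /\ refutes sigma i (Gamma ⊢ Delta).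
Proof.
move=> [h1 h2]; split; first by apply: h1; rewrite fset1U1.
by split=> // B BG; apply: h1; rewrite fset1Ur.
Qed.

Lemma refutesU1R (Atm : countType) sigma i (A : form Atm) Gamma Delta :
  refutes sigma i (Gamma ⊢ A |` Delta) ->
  ~ sat sigma i A /\ refutes sigma i (Gamma ⊢ Delta).
Proof.
move=> [h1 h2]; split; first by apply: h2; rewrite fset1U1.
by split=> // B BG; apply: h2; rewrite fset1Ur.
Qed.

(** The expansion law of until, on which the invertibility of its rules rests. *)
Lemma sat_Until (Atm : Type) (sigma : state_sequence Atm) i A B :
  sat sigma i (Until A B) <->
  sat sigma i B \/ sat sigma i A /\ sat sigma i.+1 (Until A B).
Proof.
split=> /= [[j [ij sB sA]]|[sB|[sA [j [ij sB sA']]]]].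
- case: (eqVneq i j) => [->|ne_ij]; first by left.
  right; split; first by apply: sA; lia.
  by exists j; split=> //; [lia|move=> n hn; apply: sA; lia].
- by exists i; split=> // n; rewrite ltnNge andbN.
- exists j; split=> //; first lia.
  move=> n hn; have [->|ne_in] := eqVneq n i => //.
  by apply: sA'; lia.
Qed.

(** Invertibility of the rules, in contrapositive form: a countermodel of a premise is a
    countermodel of the conclusion. *)
Lemma expand_refutes (Atm : countType) b (T T' : sequent Atm) R R' sigma i :
  expand b T R T' R' -> lns_refutes sigma i (T' :: R') ->
  lns_refutes sigma i (T :: R).
Proof.
case=> {b T T' R R'} Gamma Delta R A => [B|B|B|||B|B|B|B] _ [hT hR].
- case/refutesU1L: hT => sA /refutesU1R [sB hT]; split=> //.
  by apply: refutesD1R hT => -[].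
- case/refutesU1L: hT => sB hT; split=> //.
  by apply: refutesD1L hT; right.
- case/refutesU1R: hT => sB hT; split=> //.
  by apply: refutesD1L hT; left.
- by case/pushL_refutes: hR => sA hR; split=> //; apply: refutesD1L hT.
- by case/pushR_refutes: hR => sA hR; split=> //; apply: refutesD1R hT.
- case/refutesU1L: hT => sB hT; split=> //.
  by apply: refutesD1L hT; apply/sat_Until; left.
- case/refutesU1L: hT => sA hT; case/pushL_refutes: hR => sU hR; split=> //.
  by apply: refutesD1L hT; apply/sat_Until; right.
- case/refutesU1R: hT => sA /refutesU1R [sB hT]; split=> //.
  by apply: refutesD1R hT => /sat_Until [|[]].
- case/refutesU1R: hT => sB hT; case/pushR_refutes: hR => sU hR; split=> //.
  by apply: refutesD1R hT => /sat_Until [|[]].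
Qed.

Lemma expand_irrefutable (Atm : countType) b (T T' : sequent Atm) R R' H :
  expand b T R T' R' -> irrefutable (H ++ T :: R) -> irrefutable (H ++ T' :: R').
Proof.
move=> ex irr sigma /lns_refutes_cat [hH /(expand_refutes ex) hT].
by apply: (irr sigma); apply/lns_refutes_cat.
Qed.

(** * Complete decomposition of a component along one branch *)

Definition next_seqt (Atm : countType) (R : lns Atm) : sequent Atm :=
  head (fset0 ⊢ fset0) R.

Definition seqt_sub (Atm : countType) (T S : sequent Atm) : Prop :=
  (forall A, A \in T.1 -> A \in S.1) /\ (forall A, A \in T.2 -> A \in S.2).

Definition over (Atm : countType) (cl : {fset form Atm}) (T : sequent Atm) : bool :=
  (T.1 `<=` cl) && (T.2 `<=` cl).

Definition subclosed (Atm : countType) (cl : {fset form Atm}) : Prop :=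
  forall A, A \in cl ->
  match A with
  | Imp B C | Until B C => B \in cl /\ C \in cl
  | Next B => B \in cl
  | _ => True
  end.

(** As [open_step], but with consistency replaced by the demand that all non-compound members of [L]
    and [R] survive in [T']. Any clash would then show in [T'], so consistency follows once [T'] is
    not axiomatic. *)
Definition opens (Atm : countType) (T T' S : sequent Atm) : Prop :=
  exists L R, [/\ forall A, A \in T.1 -> L A, forall A, A \in T.2 -> R A,
    decomposed L R (fun A => A \in S.1) (fun A => A \in S.2) &
    forall A, ~~ compound A -> (L A -> A \in T'.1) /\ (R A -> A \in T'.2)].

(* Result of decomposing [T] completely along one branch, from [H ++ T :: R]
   to [H ++ T' :: R']; [b] tells whether the branch goes through the right
   premise of a left until rule. *)
Record outcome (Atm : countType) (b : bool) (T : sequent Atm) (R : lns Atm)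
    (T' : sequent Atm) (R' : lns Atm) : Prop := {
  outcome_behead : behead R' = behead R;
  outcome_size : size R <= size R';
  outcome_next : seqt_sub (next_seqt R) (next_seqt R');
  outcome_over : forall cl, subclosed cl -> over cl T -> all (over cl) R ->
    all (over cl) R';
  outcome_opens : ~~ b -> opens T T' (next_seqt R')
}.

Lemma opens_open_step (Atm : countType) (T T' S : sequent Atm) :
  ~~ axiomatic T' -> opens T T' S -> open_step T S.
Proof.
move=> /axiomaticPn [nB nA] [L [R [hL hR dec at_]]]; exists L, R; split=> //.
split=> [/(proj1 (at_ Bot isT)) //|p /(proj1 (at_ (Atom p) isT)) lp].
by move/(proj2 (at_ (Atom p) isT)); apply: nA.
Qed.

(** Undoes one expansion: the principal formula [X] joins the left set found for the premise. Being
    compound, it does not affect the condition on survivors in [T']. *)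
Lemma opens_addL (Atm : countType) X (Gamma Delta Gamma' Delta' : {fset form Atm})
    (T' S : sequent Atm) :
  compound X ->
  {subset Gamma <= X |` Gamma'} -> {subset Delta <= Delta'} ->
  decomposesL (fun A => A \in Gamma') (fun A => A \in Delta')
    (fun A => A \in S.1) X ->
  opens (Gamma' ⊢ Delta') T' S -> opens (Gamma ⊢ Delta) T' S.
Proof.
move=> cX hG hD dX [L [R [hL hR [dL dR] at_]]].
exists (fun A => L A \/ A = X), R; split.
- by move=> A /hG; rewrite !inE => /orP [/eqP|/hL]; [right|left].
- by move=> A /hD /hR.
- split=> A.
    by case=> [/dL|->]; [|move: dX]; apply: decomposesL_mono => //= B ?; auto.
  by move/dR; apply: decomposesR_mono => // B; left.
- move=> A nA; split; last exact: (proj2 (at_ A nA)).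
  by case=> [|AX]; [exact: (proj1 (at_ A nA))|move: nA; rewrite AX cX].
Qed.

Lemma opens_addR (Atm : countType) X (Gamma Delta Gamma' Delta' : {fset form Atm})
    (T' S : sequent Atm) :
  compound X ->
  {subset Gamma <= Gamma'} -> {subset Delta <= X |` Delta'} ->
  decomposesR (fun A => A \in Gamma') (fun A => A \in Delta')
    (fun A => A \in S.2) X ->
  opens (Gamma' ⊢ Delta') T' S -> opens (Gamma ⊢ Delta) T' S.
Proof.
move=> cX hG hD dX [L [R [hL hR [dL dR] at_]]].
exists L, (fun A => R A \/ A = X); split.
- by move=> A /hG /hL.
- by move=> A /hD; rewrite !inE => /orP [/eqP|/hR]; [right|left].
- split=> A.
    by move/dL; apply: decomposesL_mono => // B; left.
  by case=> [/dR|->]; [|move: dX]; apply: decomposesR_mono => //= B ?; auto.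
- move=> A nA; split; first exact: (proj1 (at_ A nA)).
  by case=> [|AX]; [exact: (proj2 (at_ A nA))|move: nA; rewrite AX cX].
Qed.

Lemma pushL_next (Atm : countType) (A : form Atm) R :
  A \in (next_seqt (pushL A R)).1 /\ seqt_sub (next_seqt R) (next_seqt (pushL A R)).
Proof.
case: R => [|[Sigma Pi] R] /=; first by split; [rewrite inE|split=> B /=; rewrite ?inE].
by rewrite fset1U1; split=> //; split=> B BS //=; rewrite fset1Ur.
Qed.

Lemma pushR_next (Atm : countType) (A : form Atm) R :
  A \in (next_seqt (pushR A R)).2 /\ seqt_sub (next_seqt R) (next_seqt (pushR A R)).
Proof.
case: R => [|[Sigma Pi] R] /=; first by split; [rewrite inE|split=> B /=; rewrite ?inE].
by rewrite fset1U1; split=> //; split=> B BS //=; rewrite fset1Ur.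
Qed.

Lemma over_pushL (Atm : countType) cl (A : form Atm) R :
  A \in cl -> all (over cl) R -> all (over cl) (pushL A R).
Proof.
move=> Acl; case: R => [|[Sigma Pi] R] /=; rewrite /over /= ?fsubUset fsub1set Acl //.
by rewrite fsub0set.
Qed.

Lemma over_pushR (Atm : countType) cl (A : form Atm) R :
  A \in cl -> all (over cl) R -> all (over cl) (pushR A R).
Proof.
move=> Acl; case: R => [|[Sigma Pi] R] /=; rewrite /over /= ?fsubUset fsub1set Acl //.
by rewrite fsub0set.
Qed.

Lemma seqt_sub_trans (Atm : countType) (T S U : sequent Atm) :
  seqt_sub T S -> seqt_sub S U -> seqt_sub T U.
Proof. by move=> [a b] [c d]; split=> A hA; auto. Qed.

Lemma expand_rest (Atm : countType) b (T T' : sequent Atm) R R' :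
  expand b T R T' R' ->
  [/\ behead R' = behead R, size R <= size R' &
      seqt_sub (next_seqt R) (next_seqt R')].
Proof.
have pL A U : [/\ behead (@pushL Atm A U) = behead U, size U <= size (pushL A U) &
      seqt_sub (next_seqt U) (next_seqt (pushL A U))].
  by split; [case: U => [|[]]|case: U => [|[]]|case: (pushL_next A U)].
have pR A U : [/\ behead (@pushR Atm A U) = behead U, size U <= size (pushR A U) &
      seqt_sub (next_seqt U) (next_seqt (pushR A U))].
  by split; [case: U => [|[]]|case: U => [|[]]|case: (pushR_next A U)].
by case.
Qed.

Lemma expand_over (Atm : countType) b (T T' : sequent Atm) R R' cl :
  subclosed cl -> expand b T R T' R' -> over cl T -> all (over cl) R ->
  over cl T' && all (over cl) R'.
Proof.
move=> sub ex.
have fsD (X : {fset form Atm}) A : X `<=` cl -> X `\ A `<=` cl.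
  exact/fsubset_trans/fsubD1set.
have inL (X : {fset form Atm}) A : A \in X -> X `<=` cl -> A \in cl.
  by move=> AX /fsubsetP; apply.
have U1 (X : {fset form Atm}) A : A \in cl -> X `<=` cl -> A |` X `<=` cl.
  by rewrite fsubUset fsub1set => ->.
case: ex => {b T T' R R'} Gamma Delta R A => [B|B|B|||B|B|B|B] hX
  /andP [/= hG hD] hR; rewrite /over /=.
- by have [hA hB] := sub _ (inL _ _ hX hD); rewrite !U1 ?fsD.
- by have [hA hB] := sub _ (inL _ _ hX hG); rewrite !U1 ?fsD ?hD.
- by have [hA hB] := sub _ (inL _ _ hX hG); rewrite !U1 ?fsD.
- by have hA := sub _ (inL _ _ hX hG); rewrite fsD ?hD ?over_pushL.
- by have hA := sub _ (inL _ _ hX hD); rewrite fsD ?hG ?over_pushR.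
- by have [hA hB] := sub _ (inL _ _ hX hG); rewrite !U1 ?fsD ?hD.
- have hU := inL _ _ hX hG; have [hA hB] := sub _ hU.
  by rewrite !U1 ?fsD ?hD ?over_pushL.
- by have [hA hB] := sub _ (inL _ _ hX hD); rewrite !U1 ?U1 ?fsD ?hG.
- have hU := inL _ _ hX hD; have [hA hB] := sub _ hU.
  by rewrite !U1 ?fsD ?hG ?over_pushR.
Qed.

(** Outcomes are built backwards, from the end of the branch to its start. When both flags are
    false, the principal formula of the first rule is added to the sets of the remaining branch. *)
Lemma outcome_expand (Atm : countType) b b' (T T1 T' : sequent Atm) R R1 R' :
  expand b T R T1 R1 -> outcome b' T1 R1 T' R' -> outcome (b || b') T R T' R'.
Proof.
move=> ex [bh sz nx ov op]; have [bh1 sz1 nx1] := expand_rest ex.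
split.
- by rewrite bh.
- exact: leq_trans sz.
- exact: seqt_sub_trans nx.
- by move=> cl sub oT oR; have /andP [] := expand_over sub ex oT oR; exact: ov.
rewrite negb_or => /andP [nb /op {op}].
have sD A (X : {fset form Atm}) : {subset X <= A |` (X `\ A)}.
  by move=> B BX; rewrite !inE BX andbT orbN.
have sU A (X Y : {fset form Atm}) : {subset X <= Y} -> {subset X <= A |` Y}.
  by move=> XY B /XY; rewrite !inE => ->; rewrite orbT.
have ss (X : {fset form Atm}) : {subset X <= X} by [].
have sUD A B (X : {fset form Atm}) : {subset X <= A |` (B |` (X `\ A))}.
  by move=> C CX; rewrite !inE CX andbT orbCA orbN orbT.
have sUD2 A B C (X : {fset form Atm}) : {subset X <= A |` (C |` (B |` (X `\ A)))}.
  by move=> D DX; rewrite !inE DX andbT; case: eqP; rewrite ?orbT.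
have i1 (A : form Atm) X : A \in A |` X by rewrite fset1U1.
have i2 (A B : form Atm) X : A \in B |` (A |` X) by rewrite !inE eqxx orbT.
(* [expand_UntilLr] is excluded by its flag, so a left until is always followed by its right
   argument, as [decomposesL] demands. By [nx], whatever the rule pushed is still in the next
   component at the end of the branch. *)
case: ex nb nx {bh sz ov bh1 sz1 nx1} => {b T T1 R R1} Gamma Delta R A =>
  [B|B|B|||B|B|B|B] hX //= _ nx.
- by apply: (@opens_addR _ (Imp A B)); auto.
- by apply: (@opens_addL _ (Imp A B)); auto; right.
- by apply: (@opens_addL _ (Imp A B)); auto; left.
- apply: (@opens_addL _ (Next A)); auto.
  by apply: (proj1 nx); case: (pushL_next A R).
- apply: (@opens_addR _ (Next A)); auto.
  by apply: (proj2 nx); case: (pushR_next A R).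
- by apply: (@opens_addL _ (Until A B)) => /=; auto.
- by apply: (@opens_addR _ (Until A B)) => /=; auto; split=> //; left.
- apply: (@opens_addR _ (Until A B)) => /=; auto; split=> //; right.
  by apply: (proj2 nx); case: (pushR_next (Until A B) R).
Qed.

Lemma outcome_refl (Atm : countType) (T : sequent Atm) R :
  atomic T -> outcome false T R T R.
Proof.
move=> aT; split=> // _.
exists (fun A => A \in T.1), (fun A => A \in T.2); split=> //.
exact: atomic_decomposed.
Qed.

(** * Building the cyclic proof *)

(* An environment records the labels of the proper ancestors of a node; the
   boolean tells whether the path from the ancestor to the node goes through
   the right premise of a left until rule. *)
Definition environment (Atm : countType) : Type := lns Atm -> bool -> Prop.

Definition visit (Atm : countType) (G : lns Atm) (e : environment Atm) :
    environment Atm :=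
  fun C b => e C b \/ (C = G /\ b = false).

Definition mark (Atm : countType) (m : bool) (e : environment Atm) :
    environment Atm :=
  fun C b => exists2 b', e C b' & b = m || b'.

Definition buds (Atm : countType) (C F : lns Atm) : Prop :=
  [/\ size C < size F, saturated C, saturated F &
      end_component C = end_component F].

(** A compositional form of cyclic proof: companions are sought in the environment rather than by
    address, so subtrees can be built before the tree around them is known. *)
Fixpoint closed_off (Atm : countType) (e : environment Atm) (t : dtree Atm) :
    Prop :=
  match t with
  | Leaf F => initial F \/ exists2 C, e C true & buds C F
  | Unary r G u => infer1 r (root_label u) G /\ closed_off (visit G e) u
  | Binary r G u v =>
      [/\ infer2 r (root_label u) (root_label v) G, closed_off (visit G e) u &
          closed_off (mark (is_UL r) (visit G e)) v]
  end.

Lemma visit_mono (Atm : countType) (e e' : environment Atm) G :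
  (forall C b, e C b -> e' C b) ->
  forall C b, visit G e C b -> visit G e' C b.
Proof. by move=> ee' C b [/ee'|]; [left|right]. Qed.

Lemma mark_mono (Atm : countType) (e e' : environment Atm) m :
  (forall C b, e C b -> e' C b) -> forall C b, mark m e C b -> mark m e' C b.
Proof. by move=> ee' C b [b' /ee' eb' ->]; exists b'. Qed.

Lemma closed_off_mono (Atm : countType) (e e' : environment Atm) t :
  (forall C b, e C b -> e' C b) -> closed_off e t -> closed_off e' t.
Proof.
elim: t e e' => [F|r G u IHu|r G u IHu v IHv] e e' ee' /=.
- by case=> [iF|[C /ee' eC CF]]; [left|right; exists C].
- by case=> inf /(IHu _ _ (visit_mono ee')).
- case=> inf /(IHu _ _ (visit_mono ee')) cu.
  by move/(IHv _ _ (mark_mono (visit_mono ee'))).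
Qed.

(** An inner node adds itself to the environment of its children in any case, and at a leaf the
    extra entry has flag [false], so it cannot serve as companion. *)
Lemma closed_off_root (Atm : countType) (e : environment Atm) t :
  closed_off (visit (root_label t) e) t -> closed_off e t.
Proof.
have vv G C b : visit G (visit G e) C b -> visit (Atm := Atm) G e C b.
  by move=> [|h] //; right.
case: t => [F|r G u|r G u v] /=.
- by case=> [|[C [eC|[_ //]] CF]]; [left|right; exists C].
- by case=> inf; split=> //; apply: closed_off_mono (vv G) _.
- case=> inf cu cv; split=> //; first by apply: closed_off_mono (vv G) _.
  by apply: closed_off_mono (mark_mono (vv G)) _.
Qed.

(** In continuation style: given a tree for every possible outcome, the rules leading there are
    stacked below it, by induction on the size of [T]. The continuation sees [e] marked by the flag
    of the whole branch; monotonicity adds the intermediate nodes. *)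
Lemma decompose (Atm : countType) (T : sequent Atm) (R H : lns Atm)
    (e : environment Atm) :
  irrefutable (H ++ T :: R) ->
  (forall b T' R', outcome b T R T' R' -> atomic T' ->
     ~~ has (@axiomatic Atm) (H ++ T' :: R') -> irrefutable (H ++ T' :: R') ->
     exists2 t, root_label t = H ++ T' :: R' & closed_off (mark b e) t) ->
  exists2 t, root_label t = H ++ T :: R & closed_off e t.
Proof.
have [n] := ubnP (seqt_size T); elim: n => // n IH in T R e *.
rewrite ltnS => Tn irr cont.
case ax: (has (@axiomatic Atm) (H ++ T :: R)).
  by exists (Leaf (H ++ T :: R)) => //; left; apply/initialP.
have [aT|] := boolP (atomic T).
  have [t rt ct] := cont false T R (outcome_refl R aT) aT (negbT ax) irr.
  by exists t => //; apply: closed_off_mono ct => C b [b' eb ->].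
have premise b T' R' e' : expand b T R T' R' ->
    (forall C b', mark b e C b' -> e' C b') ->
    exists2 t, root_label t = H ++ T' :: R' & closed_off e' t.
  move=> ex ee'; apply: IH; first exact: leq_trans (expand_size ex) Tn.
    exact: expand_irrefutable ex irr.
  move=> b' T2 R2 out aT2 nax2 irr2.
  have [t rt ct] := cont _ _ _ (outcome_expand ex out) aT2 nax2 irr2.
  exists t => //; apply: closed_off_mono ct => C c [b0 eb ->].
  exists (b || b0); last by rewrite orbCA orbA.
  by apply: ee'; exists b0.
case/(@expand_total _ _ R) => [[T' [R' [ex /(_ H) [r inf]]]]|].
  have [t rt ct] : exists2 t, root_label t = H ++ T' :: R' &
      closed_off (visit (H ++ T :: R) e) t.
    by apply: premise ex _ => C b [b' eb ->]; left.
  by exists (Unary r (H ++ T :: R) t); rewrite //= rt.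
case=> b [Tl [Rl [Tr [Rr [exl exr /(_ H) [r rb inf]]]]]].
have [t rt ct] : exists2 t, root_label t = H ++ Tl :: Rl &
    closed_off (visit (H ++ T :: R) e) t.
  by apply: premise exl _ => C b' [b0 eb ->]; left.
have [u ru cu] : exists2 t, root_label t = H ++ Tr :: Rr &
    closed_off (mark (is_UL r) (visit (H ++ T :: R) e)) t.
  by rewrite rb; apply: premise exr _ => C b' [b0 eb ->]; exists b0 => //; left.
by exists (Binary r (H ++ T :: R) t u); rewrite //= rt ru.
Qed.

Lemma saturated_rcons (Atm : countType) (H : lns Atm) (T : sequent Atm) :
  all (@atomic Atm) H -> ~~ has (@axiomatic Atm) (H ++ [:: T]) ->
  saturated (H ++ [:: T]).
Proof.
move=> /allP aH /initialP nax i; rewrite size_cat addn1 /= => iH.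
split=> //; first by rewrite size_cat addn1 ltnW.
by rewrite nth_cat iH; apply/allP/aH/mem_nth.
Qed.

(** Induction on the number of sequents over [cl] outside [seen]. Each seen [S] is the end of an
    ancestor, from which the path either crosses the right premise of a left until rule or amounts
    to open steps from [S] to [T]. *)
Lemma loop_search (Atm : countType) (cl : {fset form Atm}) :
  subclosed cl ->
  forall (seen : {fset {fset form Atm} * {fset form Atm}}) (H : lns Atm)
    (T : sequent Atm) (e : environment Atm),
  all (@atomic Atm) H -> over cl T -> irrefutable (H ++ [:: T]) ->
  (forall S, S \in seen -> exists C b, [/\ e C b, end_component C = S,
     saturated C, size C <= size H & b \/ clos_trans _ (@open_step Atm) S T]) ->
  exists2 t, root_label t = H ++ [:: T] & closed_off e t.
Proof.
move=> sub seen.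
pose P := fpowerset cl `*` fpowerset cl.
have [n] := ubnP #|` P `\` seen|; elim: n => // n IH in seen *.
rewrite ltnS => card_n H T e aH oT irr seenP.
case ax: (has (@axiomatic Atm) (H ++ [:: T])).
  by exists (Leaf (H ++ [:: T])) => //; left; apply/initialP.
have satT := saturated_rcons aH (negbT ax).
have nH : ~~ has (@axiomatic Atm) H.
  by move/negbT: ax; rewrite has_cat negb_or => /andP [].
have [/seenP [C [b [eC endC satC sizeC bT]]]|Tseen] := boolP (T \in seen).
  (* [T] recurs. Either the flag makes the leaf a legitimate bud, or open steps lead from [T] to
     itself and give a countermodel. *)
  case: bT => [bT|/open_loop_refuted /(_ aH nH) //].
  exists (Leaf (H ++ [:: T])) => //; right; exists C; first by rewrite -[true]bT.
  split=> //; first by rewrite size_cat addn1 ltnS.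
  by rewrite /end_component last_cat.
(* The present node enters the environment before it is decomposed, so that it can become a
   companion. *)
suff [t rt ct] : exists2 t, root_label t = H ++ [:: T] &
    closed_off (visit (H ++ [:: T]) e) t.
  by exists t => //; apply: closed_off_root; rewrite rt.
apply: decompose irr _ => b T' R' out aT' nax irr.
have aH' : all (@atomic Atm) (rcons H T') by rewrite all_rcons aT'.
(* If no component was created, the whole sequent is atomic and not initial, hence refutable.
   Otherwise exactly one was created. *)
case: R' => [|S R'] in out nax irr *.
  by case: (@atomic_refuted Atm H T'); rewrite // all_cat aH /= aT'.
have R'0 : R' = [::] := outcome_behead out.
rewrite {R'}R'0 in out nax irr *; rewrite -cat_rcons in nax irr *.
have openTS : ~~ b -> open_step T S.
  move=> /(outcome_opens out); apply: opens_open_step.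
  by move: nax; rewrite has_cat has_rcons negb_or => /andP [/norP []].
apply: (IH (T |` seen)) => //.
- apply: leq_trans card_n; apply: fproper_ltn_card.
  rewrite fproperE; apply/andP; split.
    by apply: fsetDS; apply: fsubsetU1.
  apply/fsubsetPn; exists T; last by rewrite !inE eqxx.
  by move: oT; rewrite /over !inE Tseen !fpowersetE.
- by have /andP [] := outcome_over out sub oT isT.
(* The decomposition just made links [T] to [S] by its flag or by one open step; for earlier
   sequents this link is appended to the one already known. *)
move=> S0; rewrite size_rcons !inE => /orP [/eqP ->|/seenP].
  exists (H ++ [:: T]), (b || false); split.
  - by exists false => //; right.
  - by rewrite /end_component last_cat.
  - exact: satT.
  - by rewrite size_cat addn1.
  - by case: b openTS {out} => [_|/(_ isT) TS]; [left|right; apply: t_step].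
case=> C [b0 [eC endC satC sizeC b0T]].
exists C, (b || b0); split=> //; first by exists b0 => //; left.
  exact: leqW.
case: b openTS {out} => [_|/(_ isT) TS]; first by left.
case: b0T => [->|ST]; first by left.
by right; apply: t_trans ST _; apply: t_step.
Qed.

(** The given components are decomposed from left to right without recording companions; the search
    for a loop starts at the last one. *)
Lemma closed_off_exists (Atm : countType) (cl : {fset form Atm})
    (R H : lns Atm) (T : sequent Atm) :
  subclosed cl -> all (@atomic Atm) H -> all (over cl) (T :: R) ->
  irrefutable (H ++ T :: R) ->
  exists2 t, root_label t = H ++ T :: R & closed_off (fun _ _ => False) t.
Proof.
move=> sub; have [n] := ubnP (size R); elim: n => // n IH in R H T *.
rewrite ltnS; case: R => [|S R] sz aH oT irr.
  by apply: (loop_search sub (seen := fset0)) => //; case/andP: oT.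
apply: decompose irr _ => b T' [|S' R'] out aT' nax irr.
  by have := outcome_size out.
have [t rt ct] : exists2 t, root_label t = rcons H T' ++ S' :: R' &
    closed_off (fun _ _ => False) t.
  apply: IH.
  - by rewrite (outcome_behead out : R' = R).
  - by rewrite all_rcons aT'.
  - by case/andP: oT => oT oR; exact: outcome_over out _ _ _ _.
  - by rewrite cat_rcons.
exists t; first by rewrite rt cat_rcons.
by apply: closed_off_mono ct => C b0 [].
Qed.

(** * The finite set of subformulae of a linear nested sequent *)

Fixpoint subforms (Atm : Type) (A : form Atm) : seq (form Atm) :=
  A :: match A with
       | Imp B C | Until B C => subforms B ++ subforms C
       | Next B => subforms B
       | _ => [::]
       end.

Lemma subforms_refl (Atm : countType) (A : form Atm) : A \in subforms A.
Proof. by case: A => *; rewrite mem_head. Qed.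

Lemma subforms_trans (Atm : countType) (A B C : form Atm) :
  A \in subforms B -> B \in subforms C -> A \in subforms C.
Proof.
move=> AB; elim: C => [p||C IHC D IHD|C IHC|C IHC D IHD] /=.
- by rewrite inE => /eqP eB; move: AB; rewrite eB.
- by rewrite inE => /eqP eB; move: AB; rewrite eB.
- rewrite in_cons => /orP [/eqP eB|]; first by move: AB; rewrite eB.
  by rewrite inE !mem_cat => /orP [/IHC|/IHD] ->; rewrite !orbT.
- rewrite in_cons => /orP [/eqP eB|/IHC]; first by move: AB; rewrite eB.
  by rewrite inE => ->; rewrite orbT.
- rewrite in_cons => /orP [/eqP eB|]; first by move: AB; rewrite eB.
  by rewrite inE !mem_cat => /orP [/IHC|/IHD] ->; rewrite !orbT.
Qed.

Definition subforms_lns (Atm : countType) (G : lns Atm) : {fset form Atm} :=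
  [fset A in flatten [seq flatten [seq subforms B | B <- T.1 `|` T.2] | T <- G]].

Lemma subforms_lnsP (Atm : countType) (G : lns Atm) A :
  reflect (exists T B, [/\ T \in G, B \in T.1 `|` T.2 & A \in subforms B])
          (A \in subforms_lns G).
Proof.
rewrite inE /=; apply: (iffP flatten_mapP) => [[T TG /flatten_mapP [B BT AB]]|].
  by exists T, B.
by case=> T [B [TG BT AB]]; exists T => //; apply/flatten_mapP; exists B.
Qed.

Lemma subforms_lns_closed (Atm : countType) (G : lns Atm) :
  subclosed (subforms_lns G).
Proof.
move=> A /subforms_lnsP [T [B [TG BT AB]]].
have sub C : C \in subforms A -> C \in subforms_lns G.
  by move=> CA; apply/subforms_lnsP; exists T, B; split=> //; apply: subforms_trans AB.
case: A sub {AB} => //= [C D|C|C D] sub.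
- by split; apply: sub; rewrite inE mem_cat subforms_refl !orbT.
- by apply: sub; rewrite inE subforms_refl orbT.
- by split; apply: sub; rewrite inE mem_cat subforms_refl !orbT.
Qed.

Lemma subforms_lns_over (Atm : countType) (G : lns Atm) :
  all (over (subforms_lns G)) G.
Proof.
apply/allP => T TG; apply/andP; split; apply/fsubsetP => A AT;
  by apply/subforms_lnsP; exists T, A; rewrite inE AT ?orbT subforms_refl.
Qed.

(** * From environments to addresses: extracting the cyclic proof *)

Lemma through_UL_right_cons (Atm : countType) (t u : dtree Atm) x b a :
  (forall d, subtree t (x :: d) = subtree u d) ->
  through_UL_right u b a -> through_UL_right t (x :: b) (x :: a).
Proof.
move=> tu [d1 [d2 [r [G [v [w [-> ub rUL]]]]]]].
by exists d1, d2, r, G, v, w; split=> //=; rewrite tu.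
Qed.

Lemma through_UL_right_nil (Atm : countType) (t u : dtree Atm) x a :
  (forall d, subtree t (x :: d) = subtree u d) ->
  through_UL_right u [::] a -> through_UL_right t [::] (x :: a).
Proof.
move=> tu [d1 [d2 [r [G [v [w [-> ub rUL]]]]]]].
by exists (x :: d1), d2, r, G, v, w; split=> //=; rewrite tu.
Qed.

Lemma is_companion_cons (Atm : countType) (t u : dtree Atm) x b a :
  (forall d, subtree t (x :: d) = subtree u d) ->
  is_companion u b a -> is_companion t (x :: b) (x :: a).
Proof.
move=> tu [pr ne thr [C [F [[nC nF] sz sC sF eq]]]]; split.
- by rewrite /= eqxx.
- by case.
- exact: through_UL_right_cons thr.
- by exists C, F; rewrite /node_at !tu.
Qed.

(** In the third case the companion is recorded in [e], and the required right premise is crossed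
    either before the root of [t] or inside [t]. *)
Definition leaf_closed (Atm : countType) (t : dtree Atm) (e : environment Atm)
    (a : address) (F : lns Atm) : Prop :=
  [\/ initial F, exists b, is_companion t b a |
      exists C b, [/\ e C b, b \/ through_UL_right t [::] a & buds C F]].

(** Passing from a child to its parent, a companion recorded by [visit] is found to be the root of
    [t] and gets the address [[::]]; the other recorded ones stay pending. *)
Lemma leaf_closed_cons (Atm : countType) (t u : dtree Atm) x a F (m : bool)
    (e : environment Atm) :
  (forall d, subtree t (x :: d) = subtree u d) ->
  (m -> through_UL_right t [::] (x :: a)) -> leaf_at u a F ->
  leaf_closed u (mark m (visit (root_label t) e)) a F ->
  leaf_closed t e (x :: a) F.
Proof.
move=> tu thr aF [iF|[b cb]|]; first by constructor 1.
  by constructor 2; exists (x :: b); apply: is_companion_cons cb.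
case=> C [b [[b0 vis ->] thr_u bud]].
have {}thr : b0 \/ through_UL_right t [::] (x :: a).
  case: thr_u => [/orP [/thr|]|/(through_UL_right_nil tu)]; [by right|by left|by right].
case: vis => [eC|[defC b0F]]; first by constructor 3; exists C, b0.
(* The entry made by [visit] has flag [false], so the right premise is crossed inside [t]. *)
constructor 2; exists [::]; case: thr => [|thr]; first by rewrite b0F.
case: bud => sz sC sF eq; split=> //; exists C, F; split=> //.
by rewrite /node_at tu aF defC /=; split=> //; case: (t).
Qed.

Lemma closed_off_leaf (Atm : countType) (t : dtree Atm) (e : environment Atm) a F :
  closed_off e t -> leaf_at t a F -> leaf_closed t e a F.
Proof.
have nomark (G : lns Atm) e1 C b : visit G e1 C b -> mark false (visit G e1) C b.
  by exists b.
elim: t e a => [G|r G u IHu|r G u IHu v IHv] e [|[] a] //=.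
- case=> [iG|[C eC bud]] [<-]; first by constructor 1.
  by constructor 3; exists C, true; split=> //; left.
- case=> _ cu aF; apply: (@leaf_closed_cons _ _ u _ _ _ false) => //.
  by apply: IHu aF; apply: closed_off_mono cu => C b /nomark.
- case=> inf _ cv aF; apply: (@leaf_closed_cons _ _ v _ _ _ (is_UL r)) => //.
    (* The left until rule is the one at the root itself: nothing precedes its right premise on the
       path, and [a] follows it. *)
    case: r inf {cv aF} => // inf _; exists [::], a; do 4!eexists.
      by split; [|reflexivity|left].
    by split; [|reflexivity|right].
  exact: IHv cv aF.
- case=> _ cu _ aF; apply: (@leaf_closed_cons _ _ u _ _ _ false) => //.
  by apply: IHu aF; apply: closed_off_mono cu => C b /nomark.
Qed.

Fixpoint leaf_addresses (Atm : countType) (t : dtree Atm) : seq address :=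
  match t with
  | Leaf _ => [:: [::]]
  | Unary _ _ u => [seq false :: a | a <- leaf_addresses u]
  | Binary _ _ u v => [seq false :: a | a <- leaf_addresses u] ++
                      [seq true :: a | a <- leaf_addresses v]
  end.

Lemma mem_leaf_addresses (Atm : countType) (t : dtree Atm) a F :
  leaf_at t a F -> a \in leaf_addresses t.
Proof.
elim: t a => [G|r G u IHu|r G u IHu v IHv] [|[] a] //=.
- by move/IHu => au; apply: map_f.
- by move/IHv => av; rewrite mem_cat (map_f (cons true)) ?orbT.
- by move/IHu => au; rewrite mem_cat (map_f (cons false)).
Qed.

Lemma closed_off_derivation (Atm : countType) (t : dtree Atm) (e : environment Atm) :
  closed_off e t -> derivation t.
Proof.
by elim: t e => [//|r G u IHu|r G u IHu v IHv] e /=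
  [? /IHu ?] // /IHv ?.
Qed.

Lemma closed_off_cyclic (Atm : countType) (t : dtree Atm) :
  closed_off (fun _ _ => False) t -> has_cyclic_proof (root_label t).
Proof.
move=> ct.
(* The cyclic leaves are exactly the leaves that are not initial. *)
pose cyclic a := if subtree t a is Some (Leaf F) then ~~ has (@axiomatic Atm) F
                 else false.
pose c a := epsilon (inhabits [::]) (fun b => is_companion t b a).
exists t, [fset a in [seq a <- leaf_addresses t | cyclic a]], c; split.
- by split=> //; exact: closed_off_derivation ct.
- move=> a; rewrite inE mem_filter /cyclic => /andP [+ _].
  by case E : (subtree t a) => [[F||]|] // _; exists F.
- move=> a; rewrite inE mem_filter /cyclic => /andP [+ _].
  case E : (subtree t a) => [[F||]|] // /initialP nF.
  rewrite /c; apply epsilon_spec.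
  (* The environment is empty, so no companion is left pending. *)
  by case: (closed_off_leaf ct E) => [//|//|[C [b [[]]]]].
- move=> a F aF; rewrite inE mem_filter /cyclic (mem_leaf_addresses aF) aF andbT.
  by rewrite negbK => /initialP.
Qed.

Theorem corollary5p4 (Atm : countType)
  (Atm_denumerable : exists f : nat -> Atm, bijective f)
  (G : lns Atm) (G_nonempty : G <> [::]) (G_valid : valid_lns G) :
  has_cyclic_proof G.
Proof.
have := valid_irrefutable G_nonempty G_valid.
case: G G_nonempty G_valid => // T R _ _ irr.
have [t /= rt ct] := closed_off_exists (H := [::]) (@subforms_lns_closed _ (T :: R))
  isT (subforms_lns_over _) irr.
by rewrite -rt; apply: closed_off_cyclic.
Qed.
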